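(* Let $r_{1}\leq r_{3}<r_{4}\leq r_{2}$ be real numbers, and let $c_{0}$, $c_{1}$, $T$, $G$, $A$ be positive real numbers. Let $g:(0,c_{0})\to(0,+\infty)$ be a continuous function such that $$\lim_{\sigma\to 0^{+}}\frac{g(\sigma)}{\sqrt{\sigma}}=G.$$ Let $f:(r_{1},r_{2})\times(0,T)\times[-c_{1},c_{1}]^{2}\to\mathbb{R}$ be a function such that $$\lim_{\sigma\to 0^{+}}\sup\left\{|f(r,t,p,q)|:(r,t,p,q)\in(r_{1},r_{2})\times(0,T)\times[-\sigma,\sigma]^{2}\right\}=0.$$ Let $v:(r_{1},r_{2})\times[0,T)\to\mathbb{R}$ be a function such that (v1) $v$ is continuous in $(r_{1},r_{2})\times[0,T)$; (v2) $v(r,t)\geq 0$ for every $(r,t)\in(r_{1},r_{2})\times[0,T)$; (v3) $v(r,0)>0$ for every $r\in(r_{3},r_{4})$; (v4) the partial derivative $v_{r}(r,t)$ exists for every $(r,t)\in(r_{1},r_{2})\times(0,T)$; (v5) setting $$\mathcal{P}:=\left\{(r,t)\in(r_{1},r_{2})\times(0,T):0<v(r,t)<c_{0}\right\},$$ we have that $v\in C^{2,1}(\mathcal{P})$, and $$v_{t}\geq g(v)\left\{v_{rr}+f(r,t,v,v_{r})+A\right\}$$ at every point $(r,t)\in\mathcal{P}$ at which the right-hand side is defined, that is, at which $|v(r,t)|\leq c_{1}$ and $|v_{r}(r,t)|\leq c_{1}$. Let $k_{0}:=G\sqrt{A}$ and $$\mathcal{D}:=\{(r,t)\in(r_{1},r_{2})\times[0,T):\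 r_{3}-k_{0}t<r<r_{4}+k_{0}t\}.$$ Then $v(r,t)>0$ for every $(r,t)\in\mathcal{D}$.
   Context: Here $C^{2,1}$ denotes the class of functions with two continuous derivatives with respect to the space variable and one continuous derivative with respect to time. Subscripts $r,t$ denote partial derivatives. *)

(* Defs.v *)
From HB Require Import structures.
From mathcomp Require Import all_boot all_order all_algebra.
From mathcomp Require Import all_classical all_reals all_analysis.
Set Implicit Arguments.
Unset Strict Implicit.
Unset Printing Implicit Defensive.
Import Order.TTheory GRing.Theory Num.Theory.
Import numFieldNormedType.Exports.
Local Open Scope classical_set_scope.
Local Open Scope ring_scope.

(* Functions of (r, t) are represented by total curried functions R -> R -> R;
   hypotheses only constrain them on their actual domain. [derive1] is total,
   so [d_r], [d_rr], [d_t] carry meaning only where derivability is known. *)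
Section PartialDerivatives.
Variable R : realType.
Implicit Types (v : R -> R -> R) (r t : R).

Definition d_r v r t : R := derive1 (fun x : R => v x t) r.
Definition d_rr v r t : R := d_r (d_r v) r t.
Definition d_t v r t : R := derive1 (fun s : R => v r s) t.

Definition ex_d_r v r t : Prop := derivable (fun x : R => v x t) r 1.
Definition ex_d_t v r t : Prop := derivable (fun s : R => v r s) t 1.

(* Continuity on P is joint in (r, t). *)
Definition C21 (P : set (R * R)) v : Prop :=
  (forall r t, P (r, t) ->
     [/\ ex_d_r v r t, ex_d_r (d_r v) r t & ex_d_t v r t]) /\
  [/\ {within P, continuous (fun z : R * R => v z.1 z.2)},
      {within P, continuous (fun z : R * R => d_r v z.1 z.2)},
      {within P, continuous (fun z : R * R => d_rr v z.1 z.2)} &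
      {within P, continuous (fun z : R * R => d_t v z.1 z.2)}].

End PartialDerivatives.

(* Extended-real valued, since f is not assumed to be bounded. *)
Definition sup_abs (R : realType) (r1 r2 T : R) (f : R -> R -> R -> R -> R)
    (s : R) : \bar R :=
  ereal_sup [set y | exists r t p q : R,
    [/\ r1 < r < r2, 0 < t < T, - s <= p <= s, - s <= q <= s &
        y = (`|f r t p q|)%:E]].

(* Main.v *)
Require Import Defs.
From HB Require Import structures.
From mathcomp Require Import all_boot all_order all_algebra.
From mathcomp Require Import all_classical all_reals all_analysis.
From mathcomp Require Import ring lra.
Set Implicit Arguments.
Unset Strict Implicit.
Unset Printing Implicit Defensive.
Import Order.TTheory GRing.Theory Num.Theory.
Import numFieldNormedType.Exports.
Local Open Scope classical_set_scope.
Local Open Scope ring_scope.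

(** Positivity spreads with any speed k < G sqrt A because the equation has
    compactly supported travelling subsolutions of that speed, at every small
    scale. Where v and v_r are small the inequality reads essentially
    v_t >= G sqrt v (v_rr + A), which is invariant under
    v -> l^2 v (r / l, t / l). For a bump w = A l^2 B(z) of width l, with z
    running from 0 at one end of the support to 1 at the other and the support
    moving with speed k towards its end z = 0, being a subsolution means
    k B' <= G sqrt A sqrt B (B'' + 1). The profile chosen below satisfies the
    stronger B' <= (49/50) sqrt B (B'' + 49/50) ([bump_subsolution]); as
    sqrt B (B'' + 49/50) > 0, this covers all speeds 0 <= k < G sqrt A at once,
    and the two factors 49/50 absorb the error in g ~ G sqrt and the term f
    ([bump_strict_subsolution]).

    Comparison ([bump_below]) is by first contact. Let v > w at time 0, and let
    (r, t) be a contact point with t minimal. If w > 0 there, then v = w, v_r = w_r,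
    v_rr >= w_rr and v_t <= w_t at (r, t), against strictness. If (r, t) is an
    end of the support, then v = 0 there, and v_r = 0 since v >= 0 is
    differentiable in r; but v >= w, and w leaves zero with nonzero slope. The
    bump thus needs a genuine corner at its ends. At the leading end sqrt B
    vanishes while B' does not, so B'' must blow up like 1 / sqrt z: this is why
    B contains a multiple of z^(3/2).

    Finally, if (r, t) is in the region D, t > 0, some rho in ]r3, r4[ has
    |r - rho| < G t sqrt A; a narrow bump placed below v (., 0) around rho and
    travelling to r in time t shows that v (r, t) > 0. *)

(** * One-variable calculus at a minimum *)

Lemma is_derive_approx (R : realType) (f : R -> R) (x l e : R) :
  is_derive x 1 f l -> 0 < e ->
  exists2 d, 0 < d & forall h, `|h| < d -> `|f (x + h) - f x - l * h| <= e * `|h|.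
Proof.
move=> [df dl] e0.
have := df; rewrite /derivable => /cvg_ex[/= l' cl'].
have ll' : l' = l by rewrite -dl /derive; apply/esym/cvg_lim.
rewrite ll' in cl'.
move/cvgrPdist_le : cl' => /(_ _ e0) /nbhs_ballP[d /= d0 H]; exists d => // h hd.
have [->|h0] := eqVneq h 0; first by rewrite addr0 subrr mulr0 subr0 normr0 mulr0.
have := H h; rewrite /ball /= sub0r normrN => /(_ hd h0).
rewrite [(h *: 1)]mulr1 [h + x]addrC /GRing.scale /=.
have -> : f (x + h) - f x - l * h = - ((l - h^-1 * (f (x + h) - f x)) * h) by field.
by rewrite normrN normrM => le; rewrite ler_wpM2r.
Qed.

(** With [e] = 1 or -1 this handles right and left one-sided bounds alike. *)
Lemma slope_le_derive (R : realType) (f : R -> R) (x l m e d : R) :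
  is_derive x 1 f l -> `|e| = 1 -> 0 < d ->
  (forall h, 0 < h < d -> f x + m * h <= f (x + e * h)) -> m <= e * l.
Proof.
move=> df e1 d0 H; rewrite leNgt; apply/negP => lm.
have [|d' d'0 approx] := @is_derive_approx R f x l ((m - e * l) / 2) df; first lra.
pose h := Num.min d d' / 2.
have md : Num.min d d' <= d by rewrite ge_min lexx.
have md' : Num.min d d' <= d' by rewrite ge_min lexx orbT.
have m0 : 0 < Num.min d d' by rewrite lt_min d0.
have h0 : 0 < h by rewrite /h; lra.
have hd : h < d by rewrite /h; lra.
have hd' : h < d' by rewrite /h; lra.
have eh : `|e * h| = h by rewrite normrM e1 mul1r gtr0_norm.
have := approx (e * h); rewrite eh => /(_ hd').
rewrite ler_norml => /andP[_ up].
have := H h; rewrite h0 hd => /(_ isT) lo.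
suff : (m - e * l) / 2 * h <= 0 by rewrite pmulr_rle0; lra.
by nra.
Qed.

Lemma derive_local_min (R : realType) (f : R -> R) (x l d : R) :
  is_derive x 1 f l -> 0 < d ->
  (forall y, `|y - x| < d -> f x <= f y) -> l = 0.
Proof.
move=> df d0 fmin.
have slope e : `|e| = 1 -> 0 <= e * l.
  move=> e1; apply: (slope_le_derive df e1 d0) => h /andP[h0 hd].
  rewrite mul0r addr0; apply: fmin.
  by rewrite addrC addKr normrM e1 mul1r gtr0_norm.
have := slope 1 (normr1 _); have := slope (-1); rewrite normrN1 => /(_ erefl).
lra.
Qed.

(** If l < 0, then f' would be negative just to the right of x, as f' x = 0, and
    the mean value theorem would give a value of f below f x. *)
Lemma derive2_local_min (R : realType) (f f' : R -> R) (x l d : R) :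
  (forall y, `|y - x| < d -> is_derive y 1 f (f' y)) ->
  is_derive x 1 f' l -> 0 < d ->
  (forall y, `|y - x| < d -> f x <= f y) -> 0 <= l.
Proof.
move=> df df' d0 fmin.
have f'x : f' x = 0.
  apply: (derive_local_min _ d0 fmin).
  by apply: df; rewrite subrr normr0.
rewrite leNgt; apply/negP => l0.
have [|d' d'0 approx] := @is_derive_approx R f' x l (- l / 2) df'; first lra.
pose h := Num.min d d' / 2.
have md : Num.min d d' <= d by rewrite ge_min lexx.
have md' : Num.min d d' <= d' by rewrite ge_min lexx orbT.
have m0 : 0 < Num.min d d' by rewrite lt_min d0.
have h0 : 0 < h by rewrite /h; lra.
have hd : h < d by rewrite /h; lra.
have hd' : h < d' by rewrite /h; lra.
have near_x y : x <= y <= x + h -> `|y - x| < d.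
  by move=> yh; rewrite ltr_norml; lra.
have [|y yI||c cI fE] := @MVT R f f' x (x + h); first lra.
  by apply: df; apply: near_x; move: yI; rewrite in_itv /= => yI; lra.
  apply: derivable_within_continuous => y yI.
  have := df y; case=> //; apply: near_x; move: yI; by rewrite in_itv.
have := fmin (x + h); rewrite addrC addKr gtr0_norm // => /(_ hd).
move: cI; rewrite in_itv /= => cI.
have cx : 0 < c - x by lra.
have := approx (c - x); rewrite gtr0_norm // f'x (_ : x + (c - x) = c); last by ring.
have cd' : c - x < d' by lra.
move=> /(_ cd'); rewrite ler_norml => /andP[_ up].
have f'c : f' c < 0.
  have : l * (c - x) < 0 by rewrite nmulr_rlt0.
  lra.
have : f' c * (x + h - x) < 0 by rewrite nmulr_rlt0 //; lra.
lra.
Qed.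

(** * First contact *)

Lemma within_continuous_eps (R : realType) (Q : set (R * R)) (h : R * R -> R) z e :
  {within Q, continuous h} -> Q z -> 0 < e ->
  exists2 d, 0 < d & forall y, Q y -> `|y.1 - z.1| < d -> `|y.2 - z.2| < d ->
    `|h y - h z| < e.
Proof.
move=> ch Qz e0.
have : nbhs (z : subspace Q) (fun x => `|h z - h x| < e).
  by have /cvgrPdist_lt := ch z; exact.
rewrite /nbhs /= -nbhs_subspace_in // /within /= => /nbhs_ballP[d /= d0 H].
exists d => // y Qy y1 y2; rewrite distrC; apply: H => //.
by split; rewrite /ball /= distrC.
Qed.

(** The set where h <= 0 is compact, so time attains a minimum on it; at that time
    h cannot be negative anywhere, by continuity from earlier times. *)
Lemma first_contact (R : realType) (h : R -> R -> R) (t1 : R) :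
  {within [set z : R * R | 0 <= z.1 <= 1 /\ 0 <= z.2 <= t1],
    continuous (fun z => h z.1 z.2)} ->
  (forall x, 0 <= x <= 1 -> 0 < h x 0) ->
  (exists x s, [/\ 0 <= x <= 1, 0 <= s <= t1 & h x s <= 0]) ->
  exists x0 t0, [/\ 0 <= x0 <= 1, 0 < t0 <= t1, h x0 t0 = 0,
    forall x t, 0 <= x <= 1 -> 0 <= t < t0 -> 0 < h x t &
    forall x, 0 <= x <= 1 -> 0 <= h x t0].
Proof.
move=> ch h0 [x1 [s1 [x1I s1I hx1]]].
set Q := [set z : R * R | _] in ch.
pose S := Q `&` [set z | h z.1 z.2 <= 0].
have QE : Q = `[0, 1]%classic `*` `[0, t1]%classic.
  by rewrite eqEsubset; split => -[a b] [/=]; rewrite !in_itv.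
have cQ : compact Q by rewrite QE; apply: compact_setX; exact: segment_compact.
have cS : compact S.
  have : closed ((fun z => h z.1 z.2) @^-1` [set y | y <= 0] : set (subspace Q)).
    by move/continuous_closedP : ch; apply; exact: closed_le.
  move=> /closed_subspaceP[V clV VQ].
  have -> : S = Q `&` V by rewrite [RHS]setIC VQ setIC.
  exact: compact_closedI.
have [||z0 z0S z0min] := @compact_EVT_min _ R snd S _ cS.
  by exists (x1, s1).
  by apply: continuous_subspaceT => z; exact: cvg_snd.
move: z0S z0min; rewrite inE => -[]; case: z0 => x0 t0 [/= x0I t0I hx0] t0min.
have pos x t : 0 <= x <= 1 -> 0 <= t < t0 -> 0 < h x t.
  move=> xI tI; rewrite ltNge; apply/negP => hxt.
  have := t0min (x, t); rewrite inE /S /Q /= => /(_ _).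
  suff : 0 <= t <= t1 by move=> tI' /(_ (conj (conj xI tI') hxt)); lra.
  lra.
have t0gt0 : 0 < t0.
  rewrite lt_neqAle eq_sym; apply/andP; split; last by lra.
  by apply/eqP => t00; have := h0 _ x0I; rewrite -t00; lra.
have nneg x : 0 <= x <= 1 -> 0 <= h x t0.
  move=> xI; rewrite leNgt; apply/negP => hxt.
  have Qxt : Q (x, t0) by split => //=; lra.
  have [|d d0 H] := within_continuous_eps ch Qxt (_ : 0 < - h x t0 / 2).
    by rewrite divr_gt0 ?oppr_gt0.
  pose t := Num.max 0 (t0 - d / 2).
  have t_ge0 : 0 <= t by rewrite le_max lexx.
  have t_ged : t0 - d / 2 <= t by rewrite le_max lexx orbT.
  have t_lt : t < t0 by rewrite gt_max t0gt0; lra.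
  have tI : 0 <= t < t0 by rewrite t_ge0.
  have Qxt' : Q (x, t) by split => //=; lra.
  have := pos x t xI tI; have := H (x, t) Qxt'.
  rewrite /= subrr normr0 => /(_ d0) H'.
  have /H' : `|t - t0| < d by rewrite ltr_norml; lra.
  by rewrite ltr_norml; lra.
exists x0, t0; split => //; first lra.
by apply/eqP; rewrite eq_le hx0 nneg.
Qed.

(** * The profile of the bump *)

Section Bump.
Context {R : realType}.
Implicit Types y z : R.

(** The profile factors as z (1 - sqrt z) (1 + 400 sqrt z) / 10000 on [0, 1], so it is
    positive inside and has nonzero slopes at 0 and 1. The coefficients are
    chosen so that 399 / sqrt 10000 is well above 4 / 3, which is roughly what
    [bump_subsolution] requires at z = 0, and so that 800 / 10000, the concave
    part of the second derivative, is small. *)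
Definition bump z : R := (z + 399 * (z * Num.sqrt z) - 400 * z ^+ 2) / 10000.
Definition dbump z : R := (1 + 1197 / 2 * Num.sqrt z - 800 * z) / 10000.
Definition d2bump z : R := (1197 / 4 / Num.sqrt z - 800) / 10000.

Let scaleE (a b : R) : a *: b = a * b. Proof. by []. Qed.

Lemma bump_at0 : bump 0 = 0. Proof. by rewrite /bump; ring. Qed.

Lemma bump_at1 : bump 1 = 0.
Proof. by rewrite /bump sqrtr1; ring. Qed.

Lemma continuous_bump : continuous bump.
Proof.
move=> z; rewrite /bump; apply: cvgM; last exact: cvg_cst.
have cs : Num.sqrt y @[y --> z] --> Num.sqrt z by exact: sqrt_continuous.
apply: cvgB; last by apply: cvgM; [exact: cvg_cst|exact: exprn_continuous].
apply: cvgD; first exact: cvg_id.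
by apply: cvgM; [exact: cvg_cst|apply: cvgM => //; exact: cvg_id].
Qed.

Lemma is_derive_bump z : 0 < z -> is_derive z 1 bump (dbump z).
Proof.
move=> z0; have ds := is_derive1_sqrt z0.
have y0 : 0 < Num.sqrt z by rewrite sqrtr_gt0.
have zE : z = Num.sqrt z ^+ 2 by rewrite sqr_sqrtr // ltW.
have di := is_derive_id z (1 : R).
have dM := is_deriveM di ds; have dS := is_deriveM di di.
have d := is_deriveZ 10000^-1 (is_deriveB (is_deriveD di (is_deriveZ 399 dM))
  (is_deriveZ 400 dS)).
have -> : bump = 10000^-1 \*: (id + 399 \*: (id * Num.sqrt) - 400 \*: (id * id)).
  apply/funext => y; rewrite /bump !fctE /= !scaleE.
  ring.
apply: is_derive_eq d _; rewrite /dbump !scaleE.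
set y := Num.sqrt z in y0 zE *; rewrite zE; field.
by rewrite gt_eqF.
Qed.

Lemma is_derive_dbump z : 0 < z -> is_derive z 1 dbump (d2bump z).
Proof.
move=> z0; have ds := is_derive1_sqrt z0.
have y0 : 0 < Num.sqrt z by rewrite sqrtr_gt0.
have di := is_derive_id z (1 : R); have dc := is_derive_cst (1 : R) z (1 : R).
have d := is_deriveZ 10000^-1 (is_deriveB (is_deriveD dc (is_deriveZ (1197 / 2) ds))
  (is_deriveZ 800 di)).
have -> : dbump = 10000^-1 \*: (cst 1 + (1197 / 2) \*: Num.sqrt - 800 \*: id).
  apply/funext => y; rewrite /dbump !fctE /= !scaleE; ring.
apply: is_derive_eq d _; rewrite /d2bump !scaleE.
by field; rewrite gt_eqF.
Qed.

Lemma sqrt_unit z : 0 <= z <= 1 ->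
  [/\ 0 <= Num.sqrt z, Num.sqrt z <= 1 & z = Num.sqrt z ^+ 2].
Proof.
move=> /andP[z0 z1]; split; first exact: sqrtr_ge0.
  by rewrite -sqrtr1 ler_wsqrtr.
by rewrite sqr_sqrtr.
Qed.

(** The factor z (1 - z) records the corners at both ends of the support. *)
Lemma bump_ge : exists2 m : R,
  0 < m & forall z, 0 <= z <= 1 -> m * (z * (1 - z)) <= bump z.
Proof.
exists 20000^-1; first lra.
move=> z /sqrt_unit[]; rewrite /bump; set y := Num.sqrt z => y0 y1 ->.
have k0 : 0 <= y ^+ 2 * (1 - y) by apply: mulr_ge0; [exact: sqr_ge0|lra].
have ky0 : 0 <= y ^+ 2 * (1 - y) * y by apply: mulr_ge0.
lra.
Qed.

Lemma bump_gt0 z : 0 < z < 1 -> 0 < bump z.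
Proof.
move=> zI; have [m m0 H] := bump_ge.
have zI' : 0 <= z <= 1 by lra.
apply: lt_le_trans (H z zI'); rewrite !mulr_gt0 //; lra.
Qed.

Lemma bump_le1 z : 0 <= z <= 1 -> bump z <= 1.
Proof.
move=> /sqrt_unit[]; rewrite /bump; set y := Num.sqrt z => y0 y1 ->.
have : y ^+ 2 * (1 - y) <= 1.
  by apply: mulr_ile1; rewrite ?sqr_ge0 ?expr_le1 //; lra.
have k0 : 0 <= y ^+ 2 * (1 - y) by apply: mulr_ge0; [exact: sqr_ge0|lra].
have ky0 : 0 <= y ^+ 2 * (1 - y) * (1 - y) by apply: mulr_ge0; lra.
lra.
Qed.

Lemma dbump_le1 z : 0 <= z <= 1 -> `|dbump z| <= 1.
Proof.
move=> /sqrt_unit[]; rewrite /dbump; set y := Num.sqrt z => y0 y1 zE.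
have : 0 <= z <= 1 by rewrite zE sqr_ge0 expr_le1.
by rewrite ler_norml; lra.
Qed.

(** This is [bump_subsolution] squared, with y = sqrt z. Between the ends, where
    1/400 << y << 1, the dominant terms are
    (49/50)^2 400 y (3 + 90 y)^2 and (600 y)^2, and 4 * 3 * 90 y <= (3 + 90 y)^2
    makes the former larger. *)
Lemma bump_poly y : 0 < y -> 0 <= 1 + 1197 / 2 * y - 800 * y ^+ 2 ->
  (1 + 1197 / 2 * y - 800 * y ^+ 2) ^+ 2 <=
  (49 / 50) ^+ 2 * ((1 - y) * (1 + 400 * y)) * (1197 / 400 + 90 * y) ^+ 2.
Proof.
move=> y0 p0.
(* in this variable the difference of the two sides has moderate coefficients *)
pose u := 100 * y.
have yE : y = u / 100 by rewrite /u; field.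
have u0 : 0 < u by rewrite /u; lra.
have u2 : 0 <= u ^+ 2 by exact: sqr_ge0.
have u76 : u <= 76.
  rewrite leNgt; apply/negP => u76.
  have : 0 <= u * (u - 76) by rewrite mulr_ge0; lra.
  by move: p0; rewrite yE; lra.
(* The quadratic and quartic terms of the difference are negative, the others
   positive. For u <= 25 one part of the cubic term dominates the quartic one, and
   the rest, with the lower order terms, the quadratic one; for 25 <= u <= 76 the
   cubic term dominates both. *)
have [u25|u25] := leP u 25.
  have h1 : 0 <= u * (u - 5 / 2) ^+ 2 by rewrite mulr_ge0 ?sqr_ge0 // ltW.
  have h2 : 0 <= u ^+ 2 * u * (25 - u) by rewrite !mulr_ge0 //; lra.
  have h3 : 0 <= u * (25 - u) by rewrite mulr_ge0; lra.
  by rewrite yE; lra.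
have h1 : 0 <= u ^+ 2 * ((u - 25) * (76 - u)) by rewrite !mulr_ge0 //; lra.
have h2 : 0 <= u ^+ 2 * u by rewrite mulr_ge0 // ltW.
by rewrite yE; lra.
Qed.

Lemma d2bump_gt z : 0 < z -> 0 < d2bump z + 49 / 50.
Proof.
move=> z0; have : 0 <= (Num.sqrt z)^-1 by rewrite invr_ge0 sqrtr_ge0.
by rewrite /d2bump; lra.
Qed.

Lemma bump_subsolution z : 0 < z < 1 ->
  dbump z <= 49 / 50 * Num.sqrt (bump z) * (d2bump z + 49 / 50).
Proof.
move=> zI; have /andP[z0 z1] := zI.
have [|_ y1 zE] := @sqrt_unit z; first lra.
have y0 : 0 < Num.sqrt z by rewrite sqrtr_gt0.
rewrite /bump /dbump /d2bump; set y := Num.sqrt z in y0 y1 zE *; rewrite zE.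
set q := (1 - y) * (1 + 400 * y).
have q0 : 0 <= q by apply: mulr_ge0; lra.
have -> : (y ^+ 2 + 399 * (y ^+ 2 * y) - 400 * (y ^+ 2) ^+ 2) / 10000 = (y / 100) ^+ 2 * q.
  by rewrite /q; field.
rewrite sqrtrM ?sqr_ge0 // sqrtr_sqr ger0_norm; last by lra.
have -> : 49 / 50 * (y / 100 * Num.sqrt q) * ((1197 / 4 / y - 800) / 10000 + 49 / 50)
   = (49 / 50 * Num.sqrt q * (1197 / 400 + 90 * y)) / 10000.
  by field; rewrite gt_eqF.
apply: ler_wpM2r; first lra.
have s0 := sqrtr_ge0 q.
have rhs0 : 0 <= 49 / 50 * Num.sqrt q * (1197 / 400 + 90 * y).
  by apply: mulr_ge0; [apply: mulr_ge0; [lra|exact: s0]|lra].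
have [p0|p0] := leP 0 (1 + 1197 / 2 * y - 800 * y ^+ 2); last by lra.
rewrite -(@ler_pXn2r _ 2 isT _ _ p0 rhs0) !exprMn (sqr_sqrtr q0) -exprMn.
exact: bump_poly y0 p0.
Qed.

End Bump.

(* keeps unification from computing with the numerals inside the profile *)
Opaque bump dbump d2bump.

(** * Comparison with a travelling bump *)

Lemma is_derive_affine (R : realType) (F : R -> R) (a b x dF : R) :
  is_derive (a * x + b) 1 F dF -> is_derive x 1 (fun y => F (a * y + b)) (a * dF).
Proof.
move=> dFx.
have di := is_derive_id x (1 : R); have dc := is_derive_cst b x (1 : R).
have da : is_derive x 1 (fun y : R => a * y + b) a.
  have := is_deriveD (is_deriveZ a di) dc.
  by rewrite addr0 [a *: 1]mulr1.
by rewrite mulrC; exact: (@is_derive1_comp _ F (fun y => a * y + b)).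
Qed.

Lemma is_derive_derive1 (R : realType) (F : R -> R) (x : R) :
  derivable F x 1 -> is_derive x 1 F (derive1 F x).
Proof. by move=> dF; rewrite derive1E; exact: derivableP. Qed.

Lemma within_continuous_precomp (U V W : topologicalType) (D : set V)
  (Q : set U) (g : V -> W) (f : U -> V) :
  {within D, continuous g} -> continuous f -> (forall z, Q z -> D (f z)) ->
  {within Q, continuous (g \o f)}.
Proof.
move=> /continuous_closedP cg /continuous_closedP cf QD.
apply/continuous_closedP => C clC; apply/closed_subspaceP.
have /closed_subspaceP[E clE ED] := cg _ clC.
exists (f @^-1` E); first exact: cf.
rewrite eqEsubset; split => z [Ez Qz]; split => //.
  have : (E `&` D) (f z) by split => //; exact: QD.
  by rewrite ED => -[].
have : ((g @^-1` C) `&` D) (f z) by split => //; exact: QD.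
by rewrite -ED => -[].
Qed.

(** The bump has width [l], its centre moves along rho + c t, and the sign [sg] makes
    it move towards its end z = 0. [bump_pos z t] is the point of the line with
    coordinate [z], and [Z] the inverse. The hypothesis [super] is the only
    place where the differential inequality enters: it is asked for at
    points of contact, where the first derivatives in r agree. *)
Section Comparison.
Context {R : realType}.
Variables (r1 r2 T A rho c sg l t1 : R) (v : R -> R -> R).
Hypothesis v_cont : {within [set z : R * R | r1 < z.1 < r2 /\ 0 <= z.2 < T],
  continuous (fun z : R * R => v z.1 z.2)}.
Hypothesis v_ge0 : forall r t, r1 < r < r2 -> 0 <= t < T -> 0 <= v r t.
Hypothesis v_dr : forall r t, r1 < r < r2 -> 0 < t < T -> ex_d_r v r t.
Hypotheses (A_gt0 : 0 < A) (l_gt0 : 0 < l) (sg1 : `|sg| = 1).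
Hypotheses (t1T : t1 < T) (kge0 : 0 <= - sg * c).

Definition bump_pos z t := rho + c * t + sg * l * (z - 1 / 2).

Let Z r t := sg / l * r + (1 / 2 - sg / l * (rho + c * t)).
Let W r t := A * l ^+ 2 * bump (Z r t).

Hypothesis inside : forall z t, 0 <= z <= 1 -> 0 <= t <= t1 ->
  r1 < bump_pos z t < r2.
Hypothesis init : forall z, 0 <= z <= 1 ->
  A * l ^+ 2 * bump z < v (bump_pos z 0) 0.
Hypothesis super : forall r t z, r1 < r < r2 -> 0 < t <= t1 -> 0 < z < 1 ->
  v r t = A * l ^+ 2 * bump z -> d_r v r t = A * l * sg * dbump z ->
  [/\ ex_d_r (d_r v) r t, ex_d_t v r t &
    A * d2bump z <= d_rr v r t -> A * l * (- sg * c) * dbump z < d_t v r t].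

Let scaleE (a b : R) : a *: b = a * b. Proof. by []. Qed.

Let sgsg : sg * sg = 1.
Proof. by rewrite -expr2 -real_normK ?num_real // sg1 expr1n. Qed.

Let posK r t : bump_pos (Z r t) t = r.
Proof.
rewrite /bump_pos /Z.
have -> : rho + c * t + sg * l * (sg / l * r + (1 / 2 - sg / l * (rho + c * t)) - 1 / 2)
  = rho + c * t + (sg * sg) * (r - rho - c * t) by field; rewrite gt_eqF.
by rewrite sgsg; ring.
Qed.

Let ZK z t : Z (bump_pos z t) t = z.
Proof.
rewrite /bump_pos /Z.
have -> : sg / l * (rho + c * t + sg * l * (z - 1 / 2)) + (1 / 2 - sg / l * (rho + c * t))
  = sg * sg * (z - 1 / 2) + 1 / 2 by field; rewrite gt_eqF.
by rewrite sgsg; ring.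
Qed.

Let Z_shift r t h : Z (r + h) t = Z r t + sg * (h / l).
Proof. by rewrite /Z; ring. Qed.

Let Z_time r t h : Z r (t + h) = Z r t + (- sg * c) * (h / l).
Proof. by rewrite /Z; ring. Qed.

Let W_dr r t : 0 < Z r t ->
  is_derive r 1 (fun y => W y t) (A * l * sg * dbump (Z r t)).
Proof.
move=> z0; have d := is_deriveZ (A * l ^+ 2) (is_derive_affine (is_derive_bump z0)).
apply: is_derive_eq d _; rewrite scaleE.
by field; rewrite gt_eqF.
Qed.

Let W_drr r t : 0 < Z r t ->
  is_derive r 1 (fun y => A * l * sg * dbump (Z y t)) (A * d2bump (Z r t)).
Proof.
move=> z0; have d := is_deriveZ (A * l * sg) (is_derive_affine (is_derive_dbump z0)).
apply: is_derive_eq d _; rewrite scaleE.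
rewrite [LHS](_ : _ = A * (sg * sg) * d2bump (Z r t)); first by rewrite sgsg mulr1.
by field; rewrite gt_eqF.
Qed.

Let W_dt r t : 0 < Z r t ->
  is_derive t 1 (fun s => W r s) (A * l * (- sg * c) * dbump (Z r t)).
Proof.
have ZE s : Z r s = (- sg * c / l) * s + (1 / 2 + sg / l * (r - rho)).
  by rewrite /Z; ring.
move=> z0; have z0' := z0; rewrite ZE in z0'.
have d := is_deriveZ (A * l ^+ 2) (is_derive_affine (is_derive_bump z0')).
have -> : (fun s => W r s) = ((A * l ^+ 2) \*: fun s : R =>
    bump (- sg * c / l * s + (1 / 2 + sg / l * (r - rho)))).
  by apply/funext => s; rewrite /W ZE.
apply: is_derive_eq d _; rewrite -ZE scaleE.
by field; rewrite gt_eqF.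
Qed.

Let v_below_cont : {within [set z : R * R | 0 <= z.1 <= 1 /\ 0 <= z.2 <= t1],
  continuous (fun z => v (bump_pos z.1 z.2) z.2 - A * l ^+ 2 * bump z.1)}.
Proof.
set Q := [set z | _].
have c1 : continuous (fst : R * R -> R) by move=> z; exact: cvg_fst.
have c2 : continuous (snd : R * R -> R) by move=> z; exact: cvg_snd.
have cpos : continuous (fun z : R * R => (bump_pos z.1 z.2, z.2)).
  move=> z.
  have cp : bump_pos x.1 x.2 @[x --> z] --> bump_pos z.1 z.2.
    rewrite /bump_pos; apply: cvgD.
      apply: cvgD; first exact: cvg_cst.
      by apply: cvgM; [exact: cvg_cst|exact: c2].
    apply: cvgM; first exact: cvg_cst.
    by apply: cvgB; [exact: c1|exact: cvg_cst].
  exact: (cvg_pair cp (c2 z)).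
have cv : {within Q, continuous ((fun z : R * R => v z.1 z.2) \o
    (fun z : R * R => (bump_pos z.1 z.2, z.2)))}.
  apply: within_continuous_precomp v_cont cpos _ => w [/= w1 w2].
  by split => /=; [exact: inside|case/andP: w2 => -> /= w2; exact: le_lt_trans w2 t1T].
have cb : {within Q, continuous (fun z : R * R => A * l ^+ 2 * bump z.1)}.
  apply: continuous_subspaceT => z; apply: cvgM; first exact: cvg_cst.
  by apply: continuous_comp; [exact: c1|exact: continuous_bump].
by move=> z; apply: cvgB; [exact: cv|exact: cb].
Qed.

(** All derivatives are taken at a fixed position or at a fixed time, not along the
    moving frame, so that partial derivatives suffice without a chain rule. *)
Lemma bump_below z t : 0 <= z <= 1 -> 0 <= t <= t1 ->
  A * l ^+ 2 * bump z < v (bump_pos z t) t.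
Proof.
move=> zI tI; rewrite ltNge; apply/negP => contact.
have [||x0 [t0 [x0I t0I hx0 before at_t0]]] :=
    @first_contact R (fun z t => v (bump_pos z t) t - A * l ^+ 2 * bump z)
    t1 v_below_cont.
- by move=> x xI; rewrite subr_gt0; exact: init.
- by exists z, t; split => //; rewrite subr_le0.
pose r0 := bump_pos x0 t0.
have Zr0 : Z r0 t0 = x0 by exact: ZK.
have r0I : r1 < r0 < r2 by apply: inside => //; lra.
have t0T : 0 < t0 < T by have := t1T; lra.
have W_le y : 0 <= Z y t0 <= 1 -> W y t0 <= v y t0.
  by move=> yI; have := at_t0 _ yI; rewrite posK subr_ge0.
have v0 : v r0 t0 = W r0 t0 by rewrite /W Zr0; apply/eqP; rewrite -subr_eq0 hx0.
have dv : is_derive r0 1 (fun y => v y t0) (d_r v r0 t0).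
  by apply: is_derive_derive1; exact: v_dr.
(* Contact at an end of the support: the one-sided slopes of v towards and away
   from the bump have incompatible signs. *)
have [m m_gt0 m_bump] := @bump_ge R.
have edge e : `|e| = 1 ->
    (forall h, 0 < h < l / 2 -> Z (r0 + e * h) t0 = h / l \/ Z (r0 + e * h) t0 = 1 - h / l) ->
    bump x0 = 0 -> False.
  move=> e1 ZE b0.
  have vr0 : v r0 t0 = 0 by rewrite v0 /W Zr0 b0 mulr0.
  have inner : A * l * (m / 2) <= e * d_r v r0 t0.
    have l20 : 0 < l / 2 by rewrite divr_gt0.
    apply: (slope_le_derive dv e1 l20) => h /andP[h0 hl].
    have hl0 : 0 < h / l by rewrite divr_gt0.
    have hl2 : h / l < 1 / 2 by rewrite ltr_pdivrMr // mulrC mulrA mulr1.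
    have hlh : 0 < h < l / 2 by rewrite h0 hl.
    have hI : 0 <= Z (r0 + e * h) t0 <= 1.
      by have [->|->] := ZE h hlh; lra.
    have hbump : (m / 2) * (h / l) <= bump (Z (r0 + e * h) t0).
      apply: le_trans (m_bump _ hI).
      have mq : 0 <= m * (h / l) * (1 / 2 - h / l).
        by apply: mulr_ge0; [apply: mulr_ge0; exact: ltW|lra].
      by have [->|->] := ZE h hlh; lra.
    apply: le_trans (W_le _ hI); rewrite vr0 add0r /W.
    have -> : A * l * (m / 2) * h = A * l ^+ 2 * ((m / 2) * (h / l)).
      by field; rewrite gt_eqF.
    by apply: ler_wpM2l hbump; rewrite mulr_ge0 ?sqr_ge0 // ltW.
  have outer : 0 <= - e * d_r v r0 t0.
    pose d := Num.min (r0 - r1) (r2 - r0).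
    have d0 : 0 < d by rewrite lt_min; lra.
    have e1' : `|- e| = 1 by rewrite normrN.
    apply: (slope_le_derive dv e1' d0) => h /andP[h0 hd].
    rewrite vr0 mul0r addr0; apply: v_ge0; last by lra.
    have eh : `|- e * h| = h by rewrite normrM e1' mul1r gtr0_norm.
    move: hd; rewrite lt_min => /andP[hd1 hd2].
    have : `|- e * h| <= h by rewrite eh.
    by rewrite ler_norml; lra.
  have : 0 < A * l * (m / 2) by rewrite mulr_gt0 ?divr_gt0 // mulr_gt0.
  by lra.
have x00 : x0 != 0.
  apply/eqP => x00; apply: (edge sg sg1); last by rewrite x00 bump_at0.
  by move=> h hI; left; rewrite Z_shift Zr0 x00 add0r -mulrA mulrA sgsg mul1r.
have x01 : x0 != 1.
  apply/eqP => x01; apply: (edge (- sg)); rewrite ?normrN //; last by rewrite x01 bump_at1.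
  by move=> h hI; right; rewrite Z_shift Zr0 x01 mulNr mulNr mulrN -mulrA mulrA sgsg mul1r.
have x0I' : 0 < x0 < 1.
  by rewrite lt_neqAle eq_sym x00 lt_neqAle x01 /=; lra.
have Z0 : 0 < Z r0 t0 by rewrite Zr0; lra.
(* v - w has a spatial minimum at an interior contact point *)
pose d := l * Num.min x0 (1 - x0).
have m0 : 0 < Num.min x0 (1 - x0) by rewrite lt_min; lra.
have d0 : 0 < d by rewrite mulr_gt0.
have Z_near y : `|y - r0| < d -> 0 < Z y t0 < 1.
  move=> yd; have -> : y = r0 + (y - r0) by ring.
  rewrite Z_shift Zr0.
  have : `|sg * ((y - r0) / l)| < Num.min x0 (1 - x0).
    by rewrite normrM sg1 mul1r normrM normfV (gtr0_norm l_gt0) ltr_pdivrMr // mulrC.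
  by rewrite lt_min !ltr_norml; lra.
have diff_min y : `|y - r0| < d -> v r0 t0 - W r0 t0 <= v y t0 - W y t0.
  by move=> /Z_near yI; rewrite v0 subrr subr_ge0; apply: W_le; lra.
have d_diff y : `|y - r0| < d ->
    is_derive y 1 (fun y => v y t0 - W y t0)
      (d_r v y t0 - A * l * sg * dbump (Z y t0)).
  move=> yd; apply: is_deriveB; last by apply: W_dr; have := Z_near _ yd; lra.
  apply: is_derive_derive1; apply: v_dr => //.
  have yI : 0 <= Z y t0 <= 1 by have := Z_near _ yd; lra.
  by have := inside yI (_ : 0 <= t0 <= t1); rewrite posK; apply; lra.
have r0d : `|r0 - r0| < d by rewrite subrr normr0.
have vr_eq : d_r v r0 t0 = A * l * sg * dbump x0.
  have := derive_local_min (d_diff _ r0d) d0 diff_min.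
  by rewrite Zr0 => /eqP; rewrite subr_eq0 => /eqP.
have [|vrr vt pde] := super r0I t0I x0I' _ vr_eq; first by rewrite v0 /W Zr0.
have vrr_ge : A * d2bump x0 <= d_rr v r0 t0.
  rewrite -subr_ge0 -{1}Zr0.
  apply: (derive2_local_min d_diff _ d0 diff_min).
  by apply: is_deriveB; [exact: is_derive_derive1|exact: W_drr].
have := pde vrr_ge; apply/negP; rewrite -leNgt.
(* the fixed point r0 lies inside the moving support for a short time before t0 *)
have d_time : is_derive t0 1 (fun s => v r0 s - W r0 s)
    (d_t v r0 t0 - A * l * (- sg * c) * dbump (Z r0 t0)).
  by apply: is_deriveB; [exact: is_derive_derive1|exact: W_dt].
pose k := - sg * c.
pose dt := Num.min t0 (l * x0 / (k + 1)).
have k0 : 0 <= k by exact: kge0.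
have k1 : 0 < k + 1 by lra.
have dt0 : 0 < dt by rewrite lt_min; apply/andP; split; [lra|rewrite divr_gt0 // mulr_gt0 //; lra].
have eN1 : `|-1 : R| = 1 by rewrite normrN1.
have := @slope_le_derive R _ t0 _ 0 (-1) dt d_time eN1 dt0.
rewrite Zr0 v0 subrr => time_le.
suff : 0 <= -1 * (d_t v r0 t0 - A * l * (- sg * c) * dbump x0) by lra.
apply: time_le => h /andP[h0]; rewrite lt_min => /andP[ht hk].
rewrite mul0r addr0.
have hk' : (k + 1) * (h / l) < x0.
  by move: hk; rewrite ltr_pdivlMr // mulrA ltr_pdivrMr // mulrC [x0 * l]mulrC.
have hl0 : 0 < h / l by rewrite divr_gt0.
have khl : 0 <= k * (h / l) by rewrite mulr_ge0 // ltW.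
have ZE : Z r0 (t0 + -1 * h) = x0 - k * (h / l) by rewrite Z_time Zr0 /k; ring.
have zI' : 0 <= Z r0 (t0 + -1 * h) <= 1 by rewrite ZE; lra.
have tI' : 0 <= t0 + -1 * h < t0 by lra.
by have := before _ _ zI' tI'; rewrite posK => /ltW.
Qed.

End Comparison.

(** * Small bumps are strict subsolutions *)

(** A margin of [a] around both end points of a segment is a margin along it. *)
Lemma moving_point_inside (R : realType) (a b x y w t s : R) :
  0 < t -> 0 <= s <= t -> `|w| <= a / 2 -> 0 < a ->
  b < x - a -> b < y - a -> b < x + (y - x) / t * s + w.
Proof.
move=> t0 sI; rewrite ler_norml => /andP[wl _] a0 xa ya.
have th0 : 0 <= s / t by apply: divr_ge0; [case/andP: sI|exact: ltW].
have th1 : 0 <= 1 - s / t by rewrite subr_ge0 ler_pdivrMr // mul1r; case/andP: sI.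
have p1 : 0 <= (1 - s / t) * (x - a - b) by apply: mulr_ge0 => //; lra.
have p2 : 0 <= s / t * (y - a - b) by apply: mulr_ge0 => //; lra.
have -> : x + (y - x) / t * s = (1 - s / t) * x + s / t * y.
  by field; rewrite gt_eqF.
by clear sI; lra.
Qed.

Lemma sup_abs_small (R : realType) (r1 r2 T : R) (f : R -> R -> R -> R -> R) (e : R) :
  sup_abs r1 r2 T f @ (0 : R)^'+ --> (0 : \bar R)%E -> 0 < e ->
  \forall s \near (0 : R)^'+, forall r t p q, r1 < r < r2 -> 0 < t < T ->
    `|p| <= s -> `|q| <= s -> `|f r t p q| < e.
Proof.
move=> f0 e0.
have f_lt : \forall s \near (0 : R)^'+, (sup_abs r1 r2 T f s < e%:E)%E.
  apply: (f0 [set y | (y < e%:E)%E]).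
  by apply: open_nbhs_nbhs; split; [exact: open_ereal_lt_ereal|rewrite /= lte_fin].
apply: filterS f_lt => s sup_lt r t p q rI tI ps qs.
rewrite -lte_fin; apply: le_lt_trans sup_lt; apply: ereal_sup_ubound.
by exists r, t, p, q; rewrite -!ler_norml.
Qed.

Lemma near_sqrt_ratio_gt (R : realType) (g : R -> R) (G a : R) :
  (fun s : R => g s / Num.sqrt s) @ (0 : R)^'+ --> G -> a < G ->
  \forall s \near (0 : R)^'+, a * Num.sqrt s < g s.
Proof.
move=> gG aG; near=> s.
have s0 : 0 < Num.sqrt s by rewrite sqrtr_gt0; near: s; exact: nbhs_right_gt.
rewrite -ltr_pdivlMr //; near: s.
exact: (cvgr_gt G gG).
Unshelve. all: by end_near. Qed.

Lemma small_scale (R : realType) (A b w : R) : 0 < A -> 0 < b -> 0 < w ->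
  exists l, [/\ 0 < l, l < 1, A * l < b & l < w].
Proof.
move=> A0 b0 w0; near (0 : R)^'+ => l; exists l; split.
- by near: l; exact: nbhs_right_gt.
- by near: l; exact: nbhs_right_lt.
- rewrite mulrC -ltr_pdivlMr //; near: l.
  by apply: nbhs_right_lt; rewrite divr_gt0.
- by near: l; exact: nbhs_right_lt.
Unshelve. all: by end_near. Qed.

Lemma half_width (R : realType) (sg l z : R) : `|sg| = 1 -> 0 < l ->
  0 <= z <= 1 -> `|sg * l * (z - 1 / 2)| <= l / 2.
Proof.
move=> sg1 l0 zI; rewrite !normrM sg1 (gtr0_norm l0) [1 * l]mul1r ler_pM2l //.
by rewrite ler_norml; lra.
Qed.

Lemma bump_scaled (R : realType) (A l z : R) : 0 < A -> 0 < l -> l < 1 ->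
  0 <= z <= 1 -> A * l ^+ 2 * bump z <= A * l.
Proof.
move=> A0 l0 l1 zI.
have Al2 : 0 < A * l ^+ 2 by rewrite mulr_gt0 ?exprn_gt0.
apply: (@le_trans _ _ (A * l ^+ 2)).
  by have := ler_wpM2l (ltW Al2) (bump_le1 zI); rewrite mulr1.
by rewrite ler_pM2l // expr2 ger_pMl // ltW.
Qed.

(** The numbers [gv], [fv], [vrr] and [vt] stand for g, f, v_rr and v_t at a contact
    point. Multiplying [bump_subsolution] by k >= 0 and then
    raising k to G sqrt A on the right, which is nonnegative, treats both signs
    of the slope of the profile at once. *)
Lemma bump_strict_subsolution (R : realType) (A G l k z gv vt vrr fv : R) :
  0 < A -> 0 < G -> 0 < l -> 0 <= k < G * Num.sqrt A -> 0 < z < 1 ->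
  49 / 50 * G * Num.sqrt (A * l ^+ 2 * bump z) < gv -> `|fv| < A / 50 ->
  A * d2bump z <= vrr -> gv * (vrr + fv + A) <= vt ->
  A * l * k * dbump z < vt.
Proof.
move=> A0 G0 l0 /andP[k_ge0 k_lt] zI g_gt; rewrite ltr_norml => /andP[f_ge _].
move=> vrr_ge; apply: lt_le_trans.
have z0 : 0 < z by case/andP: zI.
have X0 : 0 < A * (d2bump z + 49 / 50) by rewrite mulr_gt0 // d2bump_gt.
have Al0 : 0 < A * l by rewrite mulr_gt0.
have g0 : 0 <= gv.
  apply: le_trans (ltW g_gt); apply: mulr_ge0; last exact: sqrtr_ge0.
  by apply: mulr_ge0; [lra|exact: ltW].
apply: (@lt_le_trans _ _ (gv * (A * (d2bump z + 49 / 50)))); last first.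
  by apply: ler_wpM2l => //; clear g_gt k_lt; lra.
have := g_gt; rewrite -(ltr_pM2r X0); apply: le_lt_trans.
pose Y := 49 / 50 * Num.sqrt (bump z) * (d2bump z + 49 / 50).
have Y0 : 0 <= Y.
  apply: mulr_ge0; last exact/ltW/d2bump_gt.
  by apply: mulr_ge0; [lra|exact: sqrtr_ge0].
have Al2 : 0 <= A * l ^+ 2 by apply: mulr_ge0; [exact: ltW|exact: sqr_ge0].
rewrite (sqrtrM _ Al2) (sqrtrM _ (ltW A0)) sqrtr_sqr (gtr0_norm l0).
have -> : 49 / 50 * G * (Num.sqrt A * l * Num.sqrt (bump z)) *
    (A * (d2bump z + 49 / 50)) = A * l * (G * Num.sqrt A * Y) by rewrite /Y; ring.
rewrite -mulrA ler_pM2l //; apply: (@le_trans _ _ (k * Y)).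
  by apply: ler_wpM2l => //; exact: bump_subsolution.
by apply: ler_wpM2r => //; exact: ltW.
Qed.

(** * Spreading of positivity *)

Theorem theorem2p6 (R : realType) (r1 r2 r3 r4 c0 c1 T G A : R)
  (hr13 : r1 <= r3) (hr34 : r3 < r4) (hr42 : r4 <= r2)
  (hc0 : 0 < c0) (hc1 : 0 < c1) (hT : 0 < T) (hG : 0 < G) (hA : 0 < A)
  (g : R -> R)
  (g_pos : forall s : R, 0 < s < c0 -> 0 < g s)
  (g_cont : {within [set s : R | 0 < s < c0], continuous g})
  (g_lim : (fun s : R => g s / Num.sqrt s) @ (0 : R)^'+ --> G)
  (f : R -> R -> R -> R -> R)
  (f_lim : sup_abs r1 r2 T f @ (0 : R)^'+ --> (0 : \bar R)%E)
  (v : R -> R -> R)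
  (v1 : {within [set z : R * R | r1 < z.1 < r2 /\ 0 <= z.2 < T],
           continuous (fun z : R * R => v z.1 z.2)})
  (v2 : forall r t : R, r1 < r < r2 -> 0 <= t < T -> 0 <= v r t)
  (v3 : forall r : R, r3 < r < r4 -> 0 < v r 0)
  (v4 : forall r t : R, r1 < r < r2 -> 0 < t < T -> ex_d_r v r t) :
  let P := [set z : R * R |
              [/\ r1 < z.1 < r2, 0 < z.2 < T & 0 < v z.1 z.2 < c0]] in
  forall (v5_C21 : C21 P v)
    (v5_ineq : forall r t : R, P (r, t) ->
       `|v r t| <= c1 -> `|d_r v r t| <= c1 ->
       g (v r t) * (d_rr v r t + f r t (v r t) (d_r v r t) + A) <= d_t v r t),
  let k0 := G * Num.sqrt A in
  let D := [set z : R * R |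
              [/\ r1 < z.1 < r2, 0 <= z.2 < T &
                  r3 - k0 * z.2 < z.1 < r4 + k0 * z.2]] in
  forall r t : R, D (r, t) -> 0 < v r t.
Proof.
move=> P v5_C21 v5_ineq k0 D r t [/= rI tI rD].
have [t_eq0|t_neq0] := eqVneq t 0.
  by rewrite t_eq0; apply: v3; move: rD; rewrite t_eq0 mulr0 subr0 addr0.
have t0 : 0 < t by rewrite lt_neqAle eq_sym t_neq0; case/andP: tI.
have k0_gt0 : 0 < k0 by rewrite mulr_gt0 // sqrtr_gt0.
have kt0 : 0 < k0 * t by rewrite mulr_gt0.
(* the starting interval and the interval reachable backwards from r overlap *)
have [rho rho34 rho_near] : exists2 rho : R, r3 < rho < r4 & `|r - rho| < k0 * t.
  pose a := Num.max r3 (r - k0 * t); pose b := Num.min r4 (r + k0 * t).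
  have : a < b by rewrite lt_min !gt_max; lra.
  have : r3 <= a by rewrite le_max lexx.
  have : r - k0 * t <= a by rewrite le_max lexx orbT.
  have : b <= r4 by rewrite ge_min lexx.
  have : b <= r + k0 * t by rewrite ge_min lexx orbT.
  move=> *; exists ((a + b) / 2); first lra.
  by rewrite ltr_norml; lra.
pose c := (r - rho) / t.
pose sg : R := if c <= 0 then 1 else -1.
have sg1 : `|sg| = 1 by rewrite /sg; case: ifP; rewrite ?normrN normr1.
have cE : - sg * c = `|c|.
  rewrite /sg; case: (leP c 0) => c_sg; first by rewrite mulN1r ler0_norm.
  by rewrite opprK mul1r gtr0_norm.
have c_lt : `|c| < k0 by rewrite normrM normfV (gtr0_norm t0) ltr_pdivrMr.
have rhoI : r1 < rho < r2 by lra.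
have v_rho : 0 < v rho 0 by exact: v3.
have [d d0 v_near] : exists2 d, 0 < d &
    forall x, r1 < x < r2 -> `|x - rho| < d -> v rho 0 / 2 < v x 0.
  have rhoQ : [set z : R * R | r1 < z.1 < r2 /\ 0 <= z.2 < T] (rho, 0).
    by split => //=; lra.
  have [|d d0 H] := within_continuous_eps v1 rhoQ (_ : 0 < v rho 0 / 2); first lra.
  exists d => // x xI xd; have := H (x, 0).
  rewrite /= subrr normr0 => /(_ _ xd d0) H'.
  have : `|v x 0 - v rho 0| < v rho 0 / 2 by apply: H'; split => //; lra.
  by rewrite ltr_norml; lra.
have A50 : 0 < A / 50 by lra.
have aG : 49 / 50 * G < G by lra.
have [s /= s0 [f_small s_c1]] : exists2 s : R, 0 < s &
    (forall r t p q, r1 < r < r2 -> 0 < t < T ->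
      `|p| <= s -> `|q| <= s -> `|f r t p q| < A / 50) /\ s <= c1.
  near (0 : R)^'+ => s; exists s.
    by near: s; exact: nbhs_right_gt.
  split; last by near: s; exact: nbhs_right_le.
  by near: s; exact: sup_abs_small.
have [e e0 g_large] : exists2 e : R, 0 < e &
    forall s, 0 < s < e -> 49 / 50 * G * Num.sqrt s < g s.
  have /nbhs_ballP[e /= e0 H] := near_sqrt_ratio_gt g_lim aG.
  exists e => // x /andP[x0 xe]; apply: H => //=.
  by rewrite /ball /= sub0r normrN gtr0_norm.
have [||l [l0 l1 Al lw]] := @small_scale R A
  (Num.min s (Num.min e (Num.min c0 (v rho 0 / 2))))
  (Num.min d (Num.min (Num.min (rho - r1) (r2 - rho)) (Num.min (r - r1) (r2 - r)))) hA.
- by rewrite !lt_min s0 e0 hc0 divr_gt0.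
- by rewrite !lt_min d0 !subr_gt0 andbACA; case/andP: rhoI => -> ->.
move: Al lw; rewrite !lt_min => /and4P[Als Ale Alc0 Alv].
move=> /and3P[ld /andP[lrho1 lrho2] /andP[lr1 lr2]].
have Al2 : 0 < A * l ^+ 2 by rewrite mulr_gt0 ?exprn_gt0.
have tT : t < T by case/andP: tI.
have rE : bump_pos rho c sg l (1 / 2) t = r.
  by rewrite /bump_pos subrr mulr0 addr0 /c; field.
rewrite -{1}rE.
have h01 : 0 < (1 / 2 : R) < 1.
  by apply/andP; split; [exact: divr_gt0|rewrite ltr_pdivrMr // mul1r ltr1n].
have b12 : 0 < A * l ^+ 2 * bump (1 / 2 : R) by rewrite mulr_gt0 // bump_gt0.
apply: lt_trans b12 _.
have inside (z t' : R) : 0 <= z <= 1 -> 0 <= t' <= t ->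
    r1 < bump_pos rho c sg l z t' < r2.
  move=> /(half_width sg1 l0) wI tI'; rewrite /bump_pos /c; apply/andP; split.
    by apply: moving_point_inside t0 tI' wI l0 _ _; rewrite ltrBrDl -ltrBrDr.
  (* the bound by r2 is the bound from below for the reflected motion *)
  have := @moving_point_inside _ l (- r2) (- rho) (- r) (- (sg * l * (z - 1 / 2))) t t' t0 tI'.
  rewrite normrN => /(_ wI l0).
  have -> : - rho + (- r - - rho) / t * t' - sg * l * (z - 1 / 2) =
    - (rho + (r - rho) / t * t' + sg * l * (z - 1 / 2)) by ring.
  by rewrite ltrN2 -!opprD !ltrN2 -!ltrBrDl; apply.
have kge0 : 0 <= - sg * c by rewrite cE.
have le01 (z : R) : 0 < z < 1 -> 0 <= z <= 1 by move=> /andP[/ltW -> /ltW ->].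
apply: (bump_below v1 v2 v4 hA l0 sg1 tT kge0 inside); last by rewrite lexx ltW.
- move=> z zI; have := half_width sg1 l0 zI.
  have tI0 : 0 <= (0 : R) <= t by rewrite lexx ltW.
  have := inside z 0 zI tI0.
  rewrite /bump_pos mulr0 addr0 => inI wI.
  apply: (@lt_trans _ _ (v rho 0 / 2)).
    exact: le_lt_trans (bump_scaled hA l0 l1 zI) Alv.
  apply: v_near inI _; rewrite addrC addKr; apply: le_lt_trans wI _.
  by apply: lt_trans ld; rewrite ltr_pdivrMr // ltr_pMr // ltr1n.
- move=> r' t' z r'I /andP[t'0 t't] zI v_eq vr_eq.
  have v_le : v r' t' <= A * l by rewrite v_eq bump_scaled // le01.
  have v_gt0 : 0 < v r' t' by rewrite v_eq mulr_gt0 // bump_gt0.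
  have t'T : 0 < t' < T by rewrite t'0 (le_lt_trans t't).
  have Pz : P (r', t') by split => //=; rewrite v_gt0 (le_lt_trans v_le).
  have [_ drr dt] := v5_C21.1 _ _ Pz; split => // vrr_ge.
  have v_s : `|v r' t'| <= s by rewrite gtr0_norm // (le_trans v_le) // ltW.
  have vr_s : `|d_r v r' t'| <= s.
    rewrite vr_eq (normrM (A * l * sg)) (normrM (A * l)) sg1 mulr1.
    rewrite (gtr0_norm (mulr_gt0 hA l0)).
    apply: le_trans (ltW Als); rewrite ger_pMr ?mulr_gt0 //.
    by apply: dbump_le1; exact: le01.
  have pde := v5_ineq r' t' Pz (le_trans v_s s_c1) (le_trans vr_s s_c1).
  apply: (bump_strict_subsolution hA hG l0 _ zI _ _ vrr_ge pde).
  + by rewrite cE normr_ge0.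
  + by rewrite -v_eq; apply: g_large; rewrite v_gt0 (le_lt_trans v_le).
  + exact: f_small.
- exact: le01.
Unshelve. all: by end_near. Qed.
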